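(* Let $M$ be a matroid of rank $4$ and let $A$ and $B$ be two disjoint bases of $M$. Then there exist an ordering $a_1\prec a_2\prec a_3\prec a_4$ of the elements of $A$ and an ordering $b_1\prec b_2\prec b_3\prec b_4$ of the elements of $B$ such that for every $i=1,2,3,4$ both $(A\setminus\{a_1,\dots,a_i\})\cup\{b_1,\dots,b_i\}$ and $(B\setminus\{b_1,\dots,b_i\})\cup\{a_1,\dots,a_i\}$ are bases of $M$. *)

(* Defs.v *)
From mathcomp Require Import all_boot.
Set Implicit Arguments.
Unset Strict Implicit.
Unset Printing Implicit Defensive.

(* The ground set of the matroid is the whole finite type E. *)
Record matroid (E : finType) := Matroid {
  indep : {set {set E}};
  indep0 : set0 \in indep;
  indepS : forall I J : {set E}, I \subset J -> J \in indep -> I \in indep;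
  indep_augment : forall I J : {set E}, I \in indep -> J \in indep ->
    #|I| < #|J| -> exists2 x, x \in J :\: I & x |: I \in indep
}.

Definition basis (E : finType) (M : matroid E) (B : {set E}) : bool :=
  maxset [pred I | I \in indep M] B.

Definition rank (E : finType) (M : matroid E) : nat :=
  \max_(I in indep M) #|I|.

Definition is_ordering (E : finType) (A : {set E}) (s : seq E) : Prop :=
  uniq s /\ [set x in s] = A.

(* The set {s_1, ..., s_i} of the first i entries of s. *)
Definition initial (E : finType) (s : seq E) (i : nat) : {set E} :=
  [set x in take i s].

(* Main.v *)
(** Say that a and b are exchangeable when A - a + b and B - b + a are bases,
    and likewise for pairs P, Q.  The sets for i = 3 are those for the single
    exchange of a4 and b4, so what is needed is an exchangeable pair of pairs
    P, Q with an edge of the exchange graph between P and Q and another one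
    between A - P and B - Q.  If there is none, symmetric exchange applied
    after a first exchange restricts the exchange graph so much that it is
    either complete or a double star: a1 is joined to all b != b1, b1 to all
    a != a1, and nothing else except possibly a1 b1.  In the complete case an
    exchangeable pair of pairs exists by looking at parallel classes in two
    rank-two contractions.  In the double star, for each d != b1 at most one
    c != a1 makes A - c + d dependent, and for each c at most one d makes
    B - d + c dependent; that is too few to exclude all nine edges c d. *)

Require Import Defs.
From mathcomp Require Import all_boot.

Set Implicit Arguments.
Unset Strict Implicit.
Unset Printing Implicit Defensive.

(** * Orderings of four-element sets *)

Ltac simp_neq :=
  repeat match goal with
  | H : is_true (?x != ?y) |- context [?x == ?y] => rewrite (negbTE H)
  | H : is_true (?x != ?y) |- context [?y == ?x] =>
      rewrite (eq_sym y x) (negbTE H)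
  end.

Ltac neqs_of U :=
  let H := fresh "neq" in
  have H := U; rewrite /= !inE !negb_or -?andbA in H;
  repeat match type of H with
  | is_true (_ && _) => let H1 := fresh "neq" in case/andP: H => H1 H
  end.

Ltac mem4 := by rewrite !inE; simp_neq; rewrite ?eqxx ?orbT.

Ltac reorder_uniq := by rewrite /= !inE; simp_neq.

Ltac reorder_set :=
  by apply/setP=> ?; rewrite !inE; do 4![case: (_ == _)].

Lemma ordering4 (E : finType) (A : {set E}) x y : #|A| = 4 ->
  x \in A -> y \in A -> x != y ->
  exists z t, is_ordering A [:: x; y; z; t].
Proof.
move=> cardA Ax Ay neqxy.
have : #|A :\: [set x; y]| = 2.
  move: cardA; rewrite (cardsD1 x) Ax (cardsD1 y) !inE eq_sym neqxy Ay.
  by rewrite setDDl => -[].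
move/eqP/cards2P=> [z [t [neqzt defzt]]]; exists z, t.
have [/setDP[_]] : z \in A :\: [set x; y] /\ t \in A :\: [set x; y].
  by rewrite defzt !inE !eqxx orbT.
rewrite !inE !negb_or => /andP[zx zy] /andP[/andP[tx ty] _]; split.
  by rewrite /= !inE !negb_or neqxy neqzt; simp_neq.
apply/setP=> u; move/setP/(_ u): defzt; rewrite !inE.
have [-> _|_] := eqVneq u x; first by rewrite Ax.
by have [-> _|_ /= <-] := eqVneq u y; first by rewrite Ay.
Qed.

Lemma ordering_swap (E : finType) (A : {set E}) x y z t :
  is_ordering A [:: x; y; z; t] -> is_ordering A [:: y; x; z; t].
Proof.
case=> U <-; neqs_of U; split; [reorder_uniq | reorder_set].
Qed.

(** * Bipartite graphs on 4 + 4 vertices forced to be a double star *)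

(** One nonedge empties the square [a3], [a4] by [b3], [b4]. A neighbour [i] of [b3] and a neighbour
    [p] of [a4] therefore lie outside it and become the centres: repeated use of the star condition
    at [i] empties the other squares, and the absence of isolated vertices then forces the edges at
    [i] and [p]. *)
Lemma double_star (E : finType) (e : rel E) (A B : {set E}) :
    #|A| = 4 -> #|B| = 4 ->
    (forall a, a \in A -> exists2 b, b \in B & e a b) ->
    (forall b, b \in B -> exists2 a, a \in A & e a b) ->
    (forall a a' b, a \in A -> a' \in A -> b \in B -> e a b -> ~~ e a' b ->
      exists b', [/\ b' \in B, b' != b &
        forall c d, c \in A :\: [set a; a'] -> d \in B :\: [set b; b'] ->
          ~~ e c d]) ->
    (exists a b, [/\ a \in A, b \in B & ~~ e a b]) ->
  exists a b, [/\ a \in A, b \in B &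
    forall c d, c \in A :\ a -> d \in B :\ b -> [&& e a d, e c b & ~~ e c d]].
Proof.
move=> cardA cardB nbrA nbrB star [a2 [b1 [Aa2 Bb1 ne21]]].
have [a1 Aa1 e11] := nbrB b1 Bb1.
have [b2 [Bb2 neqb none]] := star a1 a2 b1 Aa1 Aa2 Bb1 e11 ne21.
have neqa : a1 != a2 by apply: contraNneq ne21 => <-.
rewrite eq_sym in neqb.
have [a3 [a4 ordA]] := ordering4 cardA Aa1 Aa2 neqa.
have [b3 [b4 ordB]] := ordering4 cardB Bb1 Bb2 neqb.
have [ne33 ne34 ne43 ne44] : [/\ ~~ e a3 b3, ~~ e a3 b4, ~~ e a4 b3 & ~~ e a4 b4].
  case: ordA ordB none => UA <- [UB <-] none; neqs_of UA; neqs_of UB.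
  by split; apply: none; mem4.
have core i j p q : is_ordering A [:: i; j; a3; a4] ->
    is_ordering B [:: p; q; b3; b4] -> e i b3 -> e a4 p ->
  exists a b, [/\ a \in A, b \in B &
    forall c d, c \in A :\ a -> d \in B :\ b -> [&& e a d, e c b & ~~ e c d]].
  move=> [UA defA] [UB defB]; subst A B; neqs_of UA; neqs_of UB => ei3 e4p.
  (* The partner of b given by star is p, because of the edge k p. *)
  have center k l b : k \in [set x in [:: i; j; a3; a4]] :\: [set i; l] ->
      b \in [:: q; b3; b4] -> l \in [:: j; a3; a4] ->
      e i b -> ~~ e l b -> e k p ->
      forall c d, c \in [set x in [:: i; j; a3; a4]] :\: [set i; l] ->
        d \in [set x in [:: q; b3; b4]] :\ b -> ~~ e c d.
    move=> kA bB lA eib nelb ekp c d cA dB.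
    have [|||b' [b'B _ none']] := star i l b _ _ _ eib nelb.
    - by rewrite !inE eqxx.
    - by rewrite inE in_cons lA orbT.
    - by rewrite inE in_cons bB orbT.
    have eqb'p : b' = p.
      apply/eqP; apply: contraTT ekp => neqb'p; apply: none' => //.
      rewrite !inE eqxx /= andbT negb_or (eq_sym p b') neqb'p andbT.
      by apply: contraTneq bB => <-; rewrite !inE; simp_neq.
    rewrite eqb'p in none'; apply: none' => //; move: dB; rewrite !inE.
    case/andP=> /negbTE-> /or3P[]/eqP->; simp_neq; rewrite ?eqxx ?orbT //.
  have Nj3 := center a4 a3 b3 _ _ _ ei3 ne33 e4p.
  have [nejq nej4] : ~~ e j q /\ ~~ e j b4.
    by split; apply: Nj3; mem4.
  have ne4q : ~~ e a4 q by apply: Nj3; mem4.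
  have ei4 : e i b4.
    have [|x] := nbrB b4; first by mem4.
    by rewrite !inE => /or4P[]/eqP-> //;
      rewrite ?(negbTE nej4) ?(negbTE ne34) ?(negbTE ne44).
  have nej3 : ~~ e j b3 by apply: (center a4 a3 b4 _ _ _ ei4 ne34 e4p); mem4.
  have ejp : e j p.
    have [|x] := nbrA j; first by mem4.
    by rewrite !inE => /or4P[]/eqP-> //;
      rewrite ?(negbTE nej4) ?(negbTE nejq) ?(negbTE nej3).
  have ne3q : ~~ e a3 q by apply: (center j a4 b3 _ _ _ ei3 ne43 ejp); mem4.
  have e3p : e a3 p.
    have [|x] := nbrA a3; first by mem4.
    by rewrite !inE => /or4P[]/eqP-> //;
      rewrite ?(negbTE ne3q) ?(negbTE ne33) ?(negbTE ne34).
  have eiq : e i q.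
    have [|x] := nbrB q; first by mem4.
    by rewrite !inE => /or4P[]/eqP-> //;
      rewrite ?(negbTE nejq) ?(negbTE ne3q) ?(negbTE ne4q).
  exists i, p; split; [by mem4 | by mem4 | move=> c d].
  rewrite !inE => /andP[/negbTE-> /= cA] /andP[/negbTE-> /= dB].
  case/or3P: cA => /eqP->; case/or3P: dB => /eqP->; apply/and3P; split=> //.
have [i [j [ordA' ei3]]] : exists i j, is_ordering A [:: i; j; a3; a4] /\ e i b3.
  have [|x] := nbrB b3; first by case: ordB => _ <-; mem4.
  case: (ordA) => _ {1}<-; rewrite !inE => /or4P[]/eqP-> ex3.
  - by exists a1, a2.
  - by exists a2, a1; split=> //; apply: ordering_swap.
  - by rewrite ex3 in ne33.
  - by rewrite ex3 in ne43.
have [p [q [ordB' e4p]]] : exists p q, is_ordering B [:: p; q; b3; b4] /\ e a4 p.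
  have [|x] := nbrA a4; first by case: ordA => _ <-; mem4.
  case: (ordB) => _ {1}<-; rewrite !inE => /or4P[]/eqP-> ex3.
  - by exists b1, b2.
  - by exists b2, b1; split=> //; apply: ordering_swap.
  - by rewrite ex3 in ne43.
  - by rewrite ex3 in ne44.
exact: core ordA' ordB' ei3 e4p.
Qed.

(** * Independent sets, bases and symmetric exchange *)

Section MatroidBases.
Variables (E : finType) (M : matroid E).
Implicit Types (A B I J K P Q : {set E}) (a b c d x y : E).

Lemma indep_extend I J : I \in indep M -> J \in indep M -> #|I| <= #|J| ->
  exists K, [/\ K \in indep M, I \subset K, K \subset I :|: J & #|K| = #|J|].
Proof.
move=> indI indJ; move: {2}(#|J| - #|I|) (erefl (#|J| - #|I|)) => n.
elim: n => [|n IHn] in I indI *.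
  move/eqP; rewrite subn_eq0 => leJI leIJ; exists I; split=> //.
    exact: subsetUl.
  by apply/eqP; rewrite eqn_leq leIJ.
move=> defn leIJ; have ltIJ : #|I| < #|J| by rewrite -subn_gt0 defn.
have [x /setDP[Jx I'x] indxI] := indep_augment indI indJ ltIJ.
have cardxI : #|x |: I| = #|I|.+1 by rewrite cardsU1 I'x.
have [||K [indK sIK sKJ cardK]] := IHn _ indxI; rewrite ?cardxI //.
  by rewrite subnS defn.
exists K; split=> //; first exact: subset_trans (subsetUr _ _) sIK.
apply: subset_trans sKJ _; apply/subsetP=> y; rewrite !inE -orbA.
by case/or3P=> [/eqP-> | -> | ->]; rewrite ?Jx ?orbT.
Qed.

Lemma card_indep_leq I : I \in indep M -> #|I| <= rank M.
Proof. exact: (leq_bigmax_cond (F := fun I => #|I|)). Qed.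

Lemma basisP B : reflect (B \in indep M /\ #|B| = rank M) (basis M B).
Proof.
apply: (iffP maxsetP) => /= [[indB maxB] | [indB cardB]].
  split=> //; apply/eqP; rewrite eqn_leq card_indep_leq //=.
  apply/bigmax_leqP => I indI; rewrite leqNgt; apply/negP=> ltBI.
  have [x /setDP[_ B'x] indxB] := indep_augment indB indI ltBI.
  by case/negP: B'x; rewrite -(maxB _ indxB (subsetUr _ _)) setU11.
split=> // I indI sBI; apply/esym/eqP; rewrite eqEcard sBI cardB.
exact: card_indep_leq.
Qed.

Lemma basis_indep B : basis M B -> B \in indep M.
Proof. by case/basisP. Qed.

Lemma card_basis B : basis M B -> #|B| = rank M.
Proof. by case/basisP. Qed.

Lemma basis_swapE A x y : basis M A -> x \in A -> y \notin A ->
  basis M (y |: A :\ x) = (y |: A :\ x \in indep M).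
Proof.
move=> /basisP[_ cardA] Ax A'y; apply/basisP/idP => [[]//|->]; split=> //.
by rewrite cardsU1 !inE (negbTE A'y) andbF -cardA (cardsD1 x A) Ax.
Qed.

(* The elements b with B - b + a independent form, together with a, the
   fundamental circuit of a in B. *)
Lemma symmetric_exchange A B a : basis M A -> basis M B -> a \in A :\: B ->
  exists2 b, b \in B :\: A & basis M (b |: A :\ a) && basis M (a |: B :\ b).
Proof.
move=> bA bB /setDP[Aa B'a].
have [indA cardA] := basisP _ bA; have [indB cardB] := basisP _ bB.
pose D := [set b in B | a |: B :\ b \in indep M].
have sDB : D \subset B by apply/subsetP=> b; rewrite inE => /andP[].
have indD := indepS sDB indB.
(* Otherwise extend [a |: D] inside [a |: B] to size [#|B|]. The extension omits exactly one [b] of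
   [B], so this [b] belongs to [D] and hence to the extension. *)
have depaD : a |: D \notin indep M.
  apply/negP=> indaD.
  have leaD : #|a |: D| <= #|B| by rewrite cardB card_indep_leq.
  have [K [indK saDK sKB cardK]] := indep_extend indaD indB leaD.
  have Ka : a \in K by rewrite (subsetP saDK) ?setU11.
  have [b Bb K'b] : exists2 b, b \in B & b \notin K.
    apply/subsetPn/negP=> sBK.
    have : a |: B \subset K by rewrite subUset sub1set Ka.
    by move/subset_leq_card; rewrite cardsU1 B'a cardK ltnn.
  have sK : K \subset a |: B :\ b.
    apply/subsetP=> x Kx; have := subsetP sKB x Kx; rewrite !inE.
    have -> : x != b by apply: contraNneq K'b => <-.
    case: (x == a) => //= /orP[] // /andP[] //.
  have eqK : K = a |: B :\ b.
    apply/eqP; rewrite eqEcard sK cardK cardsU1 !inE (negbTE B'a) andbF.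
    by rewrite (cardsD1 b B) Bb leqnn.
  case/negP: K'b; apply: (subsetP saDK).
  by rewrite !inE Bb -eqK indK orbT.
have leDA : #|D| <= #|A| by rewrite cardA -cardB subset_leq_card.
(* [K] avoids [a] because [a |: D] is dependent, so augmenting [A :\ a] from [K] adds an element
   outside [A], which must come from [D]. *)
have [K [indK sDK sKA cardK]] := indep_extend indD indA leDA.
have K'a : a \notin K.
  apply: contra depaD => Ka; apply: indepS indK.
  by rewrite subUset sub1set Ka.
have indA1 : A :\ a \in indep M by apply: indepS indA; apply: subsetDl.
have [|b] := indep_augment indA1 indK; first by rewrite cardK (cardsD1 a A) Aa.
case/setDP=> Kb; rewrite !inE.
have -> /= : b != a by apply: contraNneq K'a => <-.
move=> A'b indb; have := subsetP sKA b Kb.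
rewrite !inE (negbTE A'b) orbF => /andP[Bb indaB].
by exists b; rewrite ?inE ?A'b // !basis_swapE ?indb.
Qed.

(** Augmentation from [A] can only add [a] or [a'], the rest of [A] being present already. *)
Lemma augment_two A a a' b : basis M A -> a \in A -> a' \in A -> a != a' ->
  b \notin A -> b |: A :\: [set a; a'] \in indep M ->
  basis M (b |: A :\ a) || basis M (b |: A :\ a').
Proof.
move=> bA Aa Aa' neqaa A'b indb; rewrite !basis_swapE //.
have indA := basis_indep bA.
have ltA : #|b |: A :\: [set a; a']| < #|A|.
  rewrite cardsU1 !inE (negbTE A'b) andbF (cardsD1 a A) Aa.
  by rewrite (cardsD1 a' (A :\ a)) !inE eq_sym neqaa Aa' setDDl.
have [x /setDP[Ax]] := indep_augment indb indA ltA.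
rewrite !inE Ax andbT negb_or negbK => /andP[_ /orP[]/eqP->] indx; apply/orP.
  right; apply: indepS indx; apply/subsetP=> y; rewrite !inE.
  by do 3![case: eqP => //=].
left; apply: indepS indx; apply/subsetP=> y; rewrite !inE.
by do 3![case: eqP => //=].
Qed.

(** * Exchangeable sets and the exchange graph *)

Definition exchangeable A B P Q :=
  basis M ((A :\: P) :|: Q) && basis M ((B :\: Q) :|: P).

Definition exchange_rel A B a b := exchangeable A B [set a] [set b].

Lemma exchangeableC A B P Q : exchangeable A B P Q = exchangeable B A Q P.
Proof. exact: andbC. Qed.

(** Passing to complements interchanges the two new bases; the third step of the orderings thereby
    reduces to a single exchange. *)
Lemma exchangeable_compl A B P Q : P \subset A -> Q \subset B ->
  exchangeable A B (A :\: P) (B :\: Q) = exchangeable A B P Q.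
Proof.
move=> sPA sQB; rewrite /exchangeable !setDDr !setDv !set0U.
by rewrite (setIidPr sPA) (setIidPr sQB) andbC setUC [in X in _ && X]setUC.
Qed.

Lemma exchange_relE A B a b : exchange_rel A B a b =
  basis M (b |: A :\ a) && basis M (a |: B :\ b).
Proof. by rewrite /exchange_rel /exchangeable setUC (setUC (B :\ b)). Qed.

Lemma exchange_rel_exists A B a : basis M A -> basis M B ->
  [disjoint A & B] -> a \in A -> exists2 b, b \in B & exchange_rel A B a b.
Proof.
move=> bA bB disAB Aa.
have [|b /setDP[Bb _] ab] := @symmetric_exchange A B a bA bB.
  by rewrite inE Aa (disjointFr disAB Aa).
by exists b; rewrite // exchange_relE.
Qed.

(* Exchange a' between A - a + b and B - b + a: it cannot be swapped with a. *)
Lemma exchange_rel_extend A B a a' b : [disjoint A & B] ->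
  a \in A -> a' \in A -> b \in B ->
  exchange_rel A B a b -> ~~ exchange_rel A B a' b ->
  exists b', [/\ b' \in B, b' != b & exchangeable A B [set a; a'] [set b; b']].
Proof.
move=> disAB Aa Aa' Bb ab a'b.
have neqa : a' != a by apply: contraNneq a'b => ->.
move: (ab); rewrite exchange_relE => /andP[bA1 bB1].
have notA x : x \in B -> x \notin A by move=> Bx; rewrite (disjointFl disAB Bx).
have notB x : x \in A -> x \notin B by move=> Ax; rewrite (disjointFr disAB Ax).
have neqAB x y : x \in A -> y \in B -> (x == y) = false.
  by move=> Ax By; apply: contraTF Ax => /eqP->; apply: notA.
have [|y] := symmetric_exchange bA1 bB1 (_ : a' \in _).
  by rewrite !inE (negbTE neqa) (negbTE (notB _ Aa')) Aa' andbF orbT.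
rewrite !inE => /andP[yA1 yB1].
(* If [y] were [a], the exchange of [a] would be undone, leaving the bases A - a' + b and B - b +
   a', that is, an edge [a' b]. *)
have [-> | neqya] := eqVneq y a.
  move=> bas; case/negP: a'b; rewrite exchange_relE; move: bas.
  congr (basis M _ && basis M _); apply/setP=> x; rewrite !inE.
    have [->|] := eqVneq x a; first by rewrite (eq_sym a) neqa Aa orbT.
    have [->|] //= := eqVneq x b.
    by rewrite (eq_sym b a') (neqAB a' b).
  have [->|] //= := eqVneq x a.
  by rewrite (negbTE (notB _ Aa)) andbF orbF.
move: yB1; rewrite (negbTE neqya) /= => /andP[neqyb By].
case/andP=> bA2 bB2; exists y; split=> //; apply/andP; split.
  move: bA2; congr basis; apply/setP=> x; rewrite !inE.
  have [->|] := eqVneq x y; first by rewrite !orbT.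
  have [->|] := eqVneq x b; first by rewrite (eq_sym b a') (neqAB a' b) ?orbT.
  by case: (x == a) => //=; rewrite ?andbF ?orbF.
move: bB2; congr basis; apply/setP=> x; rewrite !inE.
have [->|] := eqVneq x a'; first by rewrite !orbT.
have [->|_ _] := eqVneq x a; first by rewrite (eq_sym a y) neqya !orbT.
by case: (x == y); case: (x == b) => //=; rewrite ?orbF.
Qed.

(** Naming the edge [a b] loses nothing: the pairs are unordered, so renaming covers all four edges
    between them. *)
Definition no_crossing A B := forall a a' b b',
  [/\ a \in A, a' \in A, b \in B & b' \in B] -> a != a' -> b != b' ->
  exchangeable A B [set a; a'] [set b; b'] -> exchange_rel A B a b ->
  forall c d, c \in A :\: [set a; a'] -> d \in B :\: [set b; b'] ->
    ~~ exchange_rel A B c d.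

Lemma exchange_relC A B a b : exchange_rel A B a b = exchange_rel B A b a.
Proof. exact: exchangeableC. Qed.

Lemma no_crossingC A B : no_crossing A B -> no_crossing B A.
Proof.
move=> ncAB b b' a a' [Bb Bb' Aa Aa'] neqb neqa.
rewrite exchangeableC exchange_relC => ex eab d c dB cA.
by rewrite exchange_relC; apply: ncAB ex eab _ _ cA dB.
Qed.

(** The pairs come from [exchange_rel_extend]. The last clause provides the star condition of
    [double_star]. *)
Lemma no_crossing_star A B a a' b : [disjoint A & B] -> no_crossing A B ->
    a \in A -> a' \in A -> b \in B ->
    exchange_rel A B a b -> ~~ exchange_rel A B a' b ->
  exists b', [/\ b' \in B, b' != b, exchangeable A B [set a; a'] [set b; b'] &
    forall c d, c \in A :\: [set a; a'] -> d \in B :\: [set b; b'] ->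
      ~~ exchange_rel A B c d].
Proof.
move=> disAB ncAB Aa Aa' Bb ab a'b.
have [b' [Bb' neqb ex]] := exchange_rel_extend disAB Aa Aa' Bb ab a'b.
exists b'; split=> //; apply: (ncAB a a' b b') => //; last by rewrite eq_sym.
by apply: contraNneq a'b => <-.
Qed.

(** * The case of a double star *)

Definition star_exchange A B a1 b1 := forall c d,
  c \in A :\ a1 -> d \in B :\ b1 ->
  [&& exchange_rel A B a1 d, exchange_rel A B c b1 & ~~ exchange_rel A B c d].

Lemma star_exchangeC A B a1 b1 :
  star_exchange A B a1 b1 -> star_exchange B A b1 a1.
Proof.
move=> star d c dB cA; have := star c d cA dB.
by rewrite !(exchange_relC A B) andbCA.
Qed.

(* The exchange partner provided by no_crossing_star for (a1, c'') must be b1,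
   so {a1, c'', d} is independent for every c'' and d. *)
Lemma star_exchange_swap A B a1 b1 c c' d : #|A| = 4 -> #|B| = 4 ->
    basis M A -> [disjoint A & B] -> no_crossing A B ->
    a1 \in A -> b1 \in B -> star_exchange A B a1 b1 ->
    c \in A :\ a1 -> c' \in A :\ a1 -> c != c' -> d \in B :\ b1 ->
  basis M (d |: A :\ c) || basis M (d |: A :\ c').
Proof.
move=> cardA cardB bA disAB ncAB Aa1 Bb1 star cA c'A neqc dB.
have [/setD1P[neqca Ac] /setD1P[neqc'a Ac']] := (cA, c'A).
have /setD1P[neqdb Bd] := dB.
have [c'' c''A defA] : exists2 c'', c'' \in A :\ a1 &
    A :\: [set c; c'] = [set a1; c''].
  have [z [t [UA defA]]] := ordering4 cardA Ac Ac' neqc; neqs_of UA.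
  have : a1 \in A by [].
  rewrite -defA !inE eq_sym (negbTE neqca) eq_sym (negbTE neqc'a) /=.
  case/orP=> /eqP ->; [exists t | exists z]; try mem4;
    apply/setP=> x; rewrite !inE;
    by do 4?[case: eqVneq => [->|_]; simp_neq; rewrite ?eqxx ?orbF //=].
have neqbd : b1 != d by rewrite eq_sym.
(* A leaf [d''] other than [d] is used, so that [d] stays in B - d'' - b1 + a1 + c''. *)
have [d'' [d3 [UB defB]]] := ordering4 cardB Bb1 Bd neqbd.
have d''B : d'' \in B :\ b1 by rewrite -defB; neqs_of UB; mem4.
have /and3P[ead'' _ nec''] := star _ _ c''A d''B.
have /setD1P[neqc'' Ac''] := c''A; have /setD1P[_ Bd''] := d''B.
have [b' [Bb' neqb' ex none]] :=
  no_crossing_star disAB ncAB Aa1 Ac'' Bd'' ead'' nec''.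
(* Otherwise the edge [c b1] would join the complements of the two pairs. *)
have eqb' : b' = b1.
  apply/eqP; apply: contraT => neqb'1.
  have /and3P[_ ecb1 _] := star _ _ cA d''B.
  suff : ~~ exchange_rel A B c b1 by rewrite ecb1.
  apply: none.
    have : c \notin A :\: [set c; c'] by rewrite !inE eqxx.
    by rewrite defA => H; rewrite in_setD H Ac.
  rewrite !inE Bb1 negb_or (eq_sym b1 b') neqb'1 !andbT.
  by neqs_of UB; simp_neq.
apply: augment_two => //; first by rewrite (disjointFl disAB Bd).
rewrite defA; case/andP: ex => _ /basis_indep; apply: indepS.
rewrite subUset sub1set inE subsetUr andbT eqb' !inE Bd andbT negb_or.
by neqs_of UB; simp_neq.
Qed.

(** Two leaves [d1], [d2] suffice for the count: each admits at most one leaf [c] with B - d + c a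
    basis, yet each of the three leaves [c] needs such a [d] among these two. *)
Lemma star_exchange_crossing A B a1 b1 : #|A| = 4 -> #|B| = 4 ->
    basis M A -> basis M B -> [disjoint A & B] ->
    a1 \in A -> b1 \in B -> star_exchange A B a1 b1 -> ~ no_crossing A B.
Proof.
move=> cardA cardB bA bB disAB Aa1 Bb1 star ncAB.
have disBA : [disjoint B & A] by rewrite disjoint_sym.
have pick3 (C : {set E}) x : #|C| = 4 -> x \in C -> exists y z t,
  [/\ y \in C :\ x, z \in C :\ x, t \in C :\ x & uniq [:: y; z; t]].
  move=> cardC Cx; have [y] : exists y, y \in C :\ x.
    by apply/card_gt0P; move: cardC; rewrite (cardsD1 x) Cx add1n => -[->].
  case/setD1P=> neqyx Cy; rewrite eq_sym in neqyx.
  have [z [t [U <-]]] := ordering4 cardC Cx Cy neqyx; neqs_of U.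
  exists y, z, t; split; try mem4.
  by move: U; rewrite cons_uniq => /andP[].
have [c1 [c2 [c3 [c1A c2A c3A UC]]]] := pick3 _ _ cardA Aa1.
have [d1 [d2 [d3 [d1B d2B d3B UD]]]] := pick3 _ _ cardB Bb1.
neqs_of UC; neqs_of UD.
have col := star_exchange_swap cardA cardB bA disAB ncAB Aa1 Bb1 star.
have row := star_exchange_swap cardB cardA bB disBA (no_crossingC ncAB)
  Bb1 Aa1 (star_exchangeC star).
have nexch c d (cA : c \in A :\ a1) (dB : d \in B :\ b1) :
    ~~ (basis M (d |: A :\ c) && basis M (c |: B :\ d)).
  by case/and3P: (star c d cA dB) => _ _; rewrite exchange_relE.
have [nc12 nc13 nc23] : [/\ c1 != c2, c1 != c3 & c2 != c3] by [].
have nd12 : d1 != d2 by [].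
pose y c d := basis M (c |: B :\ d).
(* By [col], A - c + d is a basis for at least two of the three [c]; as [c d] is no edge, B - d + c
   is then not a basis. *)
have two d (dB : d \in B :\ b1) :
    [|| ~~ y c1 d && ~~ y c2 d, ~~ y c1 d && ~~ y c3 d | ~~ y c2 d && ~~ y c3 d].
  move: (nexch _ _ c1A dB) (nexch _ _ c2A dB) (nexch _ _ c3A dB).
  move: (col _ _ _ c1A c2A nc12 dB) (col _ _ _ c1A c3A nc13 dB).
  move: (col _ _ _ c2A c3A nc23 dB); rewrite -!/(y _ _).
  by do 3!case: (y _ _); do 3?[case: (basis M _)].
move: (two _ d1B) (two _ d2B) (row _ _ _ d1B d2B nd12 c1A).
move: (row _ _ _ d1B d2B nd12 c2A) (row _ _ _ d1B d2B nd12 c3A).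
by rewrite -!/(y _ _); do 6?[case: (y _ _)].
Qed.

(** * The case of a complete exchange graph, by rank-two contractions *)

Local Notation ind s := ([set x in s] \in indep M).

Lemma ind_sub (s t : seq E) : {subset s <= t} -> ind t -> ind s.
Proof.
by move=> sst; apply: indepS; apply/subsetP=> x; rewrite !inE; apply: sst.
Qed.

Lemma ind_augment (s t : seq E) : uniq t -> size s < size t -> ind s -> ind t ->
  exists x, [/\ x \in t, x \notin s & ind (x :: s)].
Proof.
move=> Ut ltst inds indt; have [|x] := indep_augment inds indt.
  by rewrite !cardsE (card_uniqP Ut) (leq_ltn_trans (card_size s)).
rewrite !inE => /andP[s'x tx] indx; exists x; split=> //.
by rewrite set_cons.
Qed.

Lemma basis_seq (s : seq E) :
  uniq s -> size s = rank M -> basis M [set x in s] = ind s.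
Proof.
move=> Us sizes; apply/basisP/idP=> [[]//|->]; split=> //.
by rewrite cardsE (card_uniqP Us).
Qed.

Lemma ordering_cat_uniq A B s t : [disjoint A & B] ->
  is_ordering A s -> is_ordering B t -> uniq (s ++ t).
Proof.
move=> disAB [Us defA] [Ut defB]; rewrite cat_uniq Us Ut andbT /=.
apply/hasPn=> x tx; apply/negP=> sx; have Ax : x \in A by rewrite -defA inE.
by move: (disjointFr disAB Ax); rewrite -defB inE tx.
Qed.

Lemma exchangeable_of_ind A B a a' a3 a4 b b' b3 b4 : rank M = 4 ->
    [disjoint A & B] ->
    is_ordering A [:: a; a'; a3; a4] -> is_ordering B [:: b; b'; b3; b4] ->
    ind [:: a3; a4; b; b'] -> ind [:: a; a'; b3; b4] ->
  exchangeable A B [set a; a'] [set b; b'].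
Proof.
move=> rankM disAB ordA ordB.
have UAB := ordering_cat_uniq disAB ordA ordB; neqs_of UAB.
case: ordA ordB => _ <- [_ <-].
rewrite -!basis_seq //; try by rewrite /= !inE; simp_neq.
move=> b1 b2; apply/andP; split; [move: b1 | move: b2]; congr basis;
  apply/setP=> x; rewrite !inE;
  by do 6?[case: eqVneq => [->|_]; simp_neq; rewrite ?eqxx ?orbF ?orbT //=];
     rewrite andNb.
Qed.

(* In the rank-two contraction by {u, v}, being parallel is transitive. *)
Lemma ind_trans u v x y z : uniq [:: u; v; x; y; z] ->
  ind [:: u; v; z] -> ind [:: u; v; x; y] ->
  ind [:: u; v; z; x] || ind [:: u; v; z; y].
Proof.
move=> U indz indxy; neqs_of U.
have [||t [tin tnin indt]] := ind_augment _ _ indz indxy => //.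
  by rewrite /= !inE; simp_neq.
apply/orP; move: tin tnin; rewrite !inE.
case/or4P=> /eqP tE; subst t; rewrite ?eqxx ?orbT // => _; [left | right];
  by apply: ind_sub indt => t; rewrite !inE => /or4P[]->; rewrite ?orbT.
Qed.

Lemma ind_perm (s t : seq E) : perm_eq s t -> ind s = ind t.
Proof.
move/perm_mem=> st; suff -> : [set x in s] = [set x in t] by [].
by apply/setP=> x; rewrite !inE st.
Qed.

Lemma ind_swap u v x y : ind [:: u; v; x; y] = ind [:: u; v; y; x].
Proof. by apply: ind_perm; rewrite !perm_cons (perm_catC [:: x] [:: y]). Qed.

(* The elements of B are not loops of the rank-two contractions by {a, a'} and
   by {a3, a4}.  If no pair were exchangeable with {a, a'}, then three elements
   of B would be parallel in both contractions, so their span would contain A. *)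
Lemma complete_exchange A B : rank M = 4 -> basis M A -> basis M B ->
    [disjoint A & B] ->
    (forall a b, a \in A -> b \in B -> exchange_rel A B a b) ->
  exists a a' b b', [/\ [/\ a \in A, a' \in A, b \in B & b' \in B],
    a != a', b != b' & exchangeable A B [set a; a'] [set b; b']].
Proof.
move=> rankM bA bB disAB full.
have [cardA cardB] : #|A| = 4 /\ #|B| = 4 by rewrite !card_basis.
have [a [a' [Aa Aa' neqa]]] : exists a a', [/\ a \in A, a' \in A & a != a'].
  by apply/card_gt1P; rewrite cardA.
have [a3 [a4 ordA]] := ordering4 cardA Aa Aa' neqa.
have [b Bb] : exists b, b \in B by apply/card_gt0P; rewrite cardB.
(* For distinct [x] and [y] in [B], [X] and [Y] say that they are not parallel in the contraction by
   [a3], [a4] and by [a], [a'] respectively. *)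
pose X x y := ind [:: a3; a4; x; y]; pose Y x y := ind [:: a; a'; x; y].
have swap x z : x \in A -> z \in B -> z |: A :\ x \in indep M.
  move=> Ax Bz; have := full x z Ax Bz.
  by rewrite exchange_relE => /andP[/basis_indep].
have neqAB x z : x \in A -> z \in B -> x != z.
  by move=> Ax Bz; apply: contraTneq Ax => ->; rewrite (disjointFl disAB Bz).
have [UA defA] := ordA; neqs_of UA.
have [Aa3 Aa4] : a3 \in A /\ a4 \in A by rewrite -defA; split; mem4.
have nlX z : z \in B -> ind [:: a3; a4; z].
  move=> Bz; apply: indepS (swap a z Aa Bz); rewrite -defA.
  apply/subsetP=> x; rewrite !inE.
  by case/or3P=> /eqP->; simp_neq; rewrite ?eqxx ?orbT.
have nlY z : z \in B -> ind [:: a; a'; z].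
  move=> Bz; apply: indepS (swap a3 z Aa3 Bz); rewrite -defA.
  apply/subsetP=> x; rewrite !inE.
  by case/or3P=> /eqP->; simp_neq; rewrite ?eqxx ?orbT.
have trans u v x y z : u \in A -> v \in A -> u != v ->
    x \in B -> y \in B -> z \in B -> uniq [:: x; y; z] ->
    ind [:: u; v; z] -> ind [:: u; v; x; y] ->
    ind [:: u; v; z; x] || ind [:: u; v; z; y].
  move=> Au Av neuv Bx By Bz U; apply: ind_trans; neqs_of U.
  by rewrite /= !inE !negb_or neuv !(neqAB u) ?(neqAB v) //; simp_neq.
have span u v z : u \in A -> v \in A -> z \in B -> ind [:: u; v; z] ->
    exists2 y, y \in B :\ z & ind [:: u; v; z; y].
  move=> Au Av Bz indz.
  have indB : ind (enum B) by rewrite set_enum basis_indep.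
  have [||y [By y' indy]] := ind_augment _ _ indz indB.
  - exact: enum_uniq.
  - by rewrite -cardE cardB.
  exists y; first by move: By y'; rewrite mem_enum !inE !negb_or => -> /and3P[_ _ ->].
  by rewrite (ind_perm (_ : perm_eq _ (y :: [:: u; v; z]))) // (perm_catC [:: u; v; z] [:: y]).
have [b' /setD1P[neqb Bb'] Xbb'] := span _ _ _ Aa3 Aa4 Bb (nlX b Bb).
rewrite eq_sym in neqb.
have [c [c' ordB]] := ordering4 cardB Bb Bb' neqb.
have [|notex] := boolP [exists p : E * E, [&& p.1 \in B, p.2 \in B,
    p.1 != p.2 & exchangeable A B [set a; a'] [set p.1; p.2]]].
  case/existsP=> -[x y] /= /and4P[Bx By neqxy ex].
  by exists a, a', x, y.
(* [X x y] and [Y z t] together would make [x], [y] an exchangeable partner of [a], [a']. *)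
have bad x y z t : is_ordering B [:: x; y; z; t] -> X x y -> ~~ Y z t.
  move=> ord Xxy; apply/negP=> Yzt; case/existsP: notex; exists (x, y) => /=.
  rewrite (exchangeable_of_ind rankM disAB ordA ord Xxy Yzt).
  by case: ord => U <-; neqs_of U; rewrite !inE; simp_neq; rewrite !eqxx !orbT.
(* Augmenting [u], [v], [y] from [w], [z], [t], [y] can only add [z] or [t]. Hence if [y] is
   parallel to both modulo [u], [v], then [u] and [v] depend on [y], [z], [t]. *)
have triple u v w y z t : u \in A -> v \in A -> w \in [:: u; v] ->
    y \in B -> z \in B -> t \in B -> uniq [:: y; z; t] -> ind [:: u; v; y] ->
    ind [:: w; z; t; y] -> ind [:: u; v; y; z] || ind [:: u; v; y; t].
  move=> Au Av wuv By Bz Bt U indy indw; neqs_of U.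
  have Aw : w \in A by move: wuv; rewrite !inE => /orP[]/eqP->.
  have [||r [rin rnin indr]] := ind_augment _ _ indy indw => //.
    by rewrite /= !inE !negb_or !(neqAB w) //; simp_neq.
  have {}rnin : r \in [:: z; t].
    move: rin rnin; rewrite !inE => /or4P[]/eqP->; rewrite ?eqxx ?orbT //.
    by move: wuv; rewrite !inE => /orP[]->; rewrite ?orbT.
  by apply/orP; move: rnin indr; rewrite !inE => /orP[]/eqP-> indr;
    [left | right]; apply: ind_sub indr => q; rewrite !inE; do 4!case: (q == _).
(* Alternating [bad] with transitivity of parallelism makes [y] parallel to [z] and to [t] in both
   contractions. *)
have core x y z t : is_ordering B [:: x; y; z; t] -> X x y -> Y z x -> False.
  move=> [U defB] Xxy Yzx; neqs_of U.
  have [Bx By Bz Bt] : [/\ x \in B, y \in B, z \in B & t \in B].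
    by rewrite -defB; split; mem4.
  have reord p q r s : uniq [:: p; q; r; s] ->
      [set v in [:: x; y; z; t]] = [set v in [:: p; q; r; s]] -> X p q -> ~~ Y r s.
    by move=> Upqrs eqs; apply: bad; rewrite -defB eqs.
  have nYzt : ~~ Y z t by apply: (bad x y).
  have nXyt : ~~ X y t.
    by apply: contraTN Yzx => /reord; apply; [reorder_uniq | reorder_set].
  have Ytx : Y t x.
    have := trans a a' z x t Aa Aa' neqa Bz Bx Bt _ (nlY t Bt) Yzx.
    rewrite -/(Y t z) -/(Y t x) {1}/Y ind_swap -/(Y z t) (negbTE nYzt).
    by apply; reorder_uniq.
  have nXyz : ~~ X y z.
    by apply: contraTN Ytx => /reord; apply; [reorder_uniq | reorder_set].
  have Xzx : X z x.
    have := trans a3 a4 x y z Aa3 Aa4 _ Bx By Bz _ (nlX z Bz) Xxy.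
    rewrite -/(X z x) [ind [:: _; _; _; y]]ind_swap -/(X y z) (negbTE nXyz) orbF.
    by apply=> //; reorder_uniq.
  have Xtx : X t x.
    have := trans a3 a4 x y t Aa3 Aa4 _ Bx By Bt _ (nlX t Bt) Xxy.
    rewrite -/(X t x) [ind [:: _; _; _; y]]ind_swap -/(X y t) (negbTE nXyt) orbF.
    by apply=> //; reorder_uniq.
  have nYyt : ~~ Y y t by apply: (reord z x) => //; [reorder_uniq | reorder_set].
  have nYyz : ~~ Y y z by apply: (reord t x) => //; [reorder_uniq | reorder_set].
  have indB : ind [:: z; t; y].
    apply: indepS (basis_indep bB); rewrite -defB; apply/subsetP=> q.
    by rewrite !inE; do 4!case: (q == _).
  have indA : ind [:: a; a'; a3; a4] by rewrite defA basis_indep.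
  (* Some [w] of [A] is independent of [z], [t], [y]; whichever half of [A] contains it, [triple]
     gives a contradiction. *)
  have [|w [win _ indw]] := ind_augment UA _ indB indA => //.
  have {}win : (w \in [:: a; a']) || (w \in [:: a3; a4]).
    by move: win; rewrite !inE -!orbA.
  have Uyzt : uniq [:: y; z; t] by reorder_uniq.
  case/orP: win => win.
    have := triple a a' w y z t Aa Aa' win By Bz Bt Uyzt (nlY y By) indw.
    by rewrite -/(Y y z) -/(Y y t) (negbTE nYyz) (negbTE nYyt).
  have := triple a3 a4 w y z t Aa3 Aa4 win By Bz Bt Uyzt (nlX y By) indw.
  by rewrite -/(X y z) -/(X y t) (negbTE nXyz) (negbTE nXyt).
have [UB defB] := ordB; neqs_of UB.
have Bc : c \in B by rewrite -defB; mem4.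
(* By [bad], this [y] is not [c'], so it is [b] or [b'], which play symmetric roles. *)
have [y /setD1P[neqy By] Ycy] := span _ _ _ Aa Aa' Bc (nlY c Bc).
have nYcc' := bad _ _ _ _ ordB Xbb'.
move: By neqy Ycy; rewrite -{1}defB !inE => /or4P[]/eqP->.
- by move=> _ Ycb; case: (core _ _ _ _ ordB Xbb' Ycb).
- move=> _ Ycb'; case: (core b' b c c') => //; first exact: ordering_swap.
  by rewrite /X ind_swap.
- by rewrite eqxx.
- by move=> _; rewrite -/(Y c c') (negbTE nYcc').
Qed.

End MatroidBases.

(** * Reading the two orderings off a crossing *)

Theorem theorem4p2 (E : finType) (M : matroid E) (A B : {set E})
  (rankM : rank M = 4) (basisA : basis M A) (basisB : basis M B)
  (disjAB : [disjoint A & B]) :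
  exists a b : 4.-tuple E,
    [/\ is_ordering A a, is_ordering B b &
        forall i : nat, 1 <= i <= 4 ->
          basis M ((A :\: initial a i) :|: initial b i) /\
          basis M ((B :\: initial b i) :|: initial a i)].
Proof.
have [cardA cardB] : #|A| = 4 /\ #|B| = 4 by rewrite !(@card_basis _ M).
(* The orderings begin with [a], [a'] and [b], [b'] and end with [c] and [d]. The successive steps
   use the edge [a b], the exchangeable pairs, the complement of the edge [c d], and the full
   interchange of [A] and [B]. *)
have sufficient a a' b b' c d : [/\ a \in A, a' \in A, b \in B & b' \in B] ->
    a != a' -> b != b' -> exchangeable M A B [set a; a'] [set b; b'] ->
    exchange_rel M A B a b -> c \in A :\: [set a; a'] ->
    d \in B :\: [set b; b'] -> exchange_rel M A B c d ->
  exists a b : 4.-tuple E, [/\ is_ordering A a, is_ordering B b &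
    forall i : nat, 1 <= i <= 4 ->
      basis M ((A :\: initial a i) :|: initial b i) /\
      basis M ((B :\: initial b i) :|: initial a i)].
  have last (C : {set E}) x y z : #|C| = 4 -> x \in C -> y \in C -> x != y ->
      z \in C :\: [set x; y] -> exists t, is_ordering C [:: x; y; t; z].
    move=> cardC Cx Cy neqxy; have [t [u ord]] := ordering4 cardC Cx Cy neqxy.
    case: (ord) => U {1}<-; rewrite !inE negb_or -andbA => /and3P[/negbTE-> /negbTE-> /=].
    case/orP=> /eqP->; last by exists t.
    exists u; case: ord => _ <-; neqs_of U; split; first reorder_uniq.
    by reorder_set.
  move=> [Aa Aa' Bb Bb'] neqa neqb ex eab cA dB ecd.
  have [a3 ordA] := last _ _ _ _ cardA Aa Aa' neqa cA.
  have [b3 ordB] := last _ _ _ _ cardB Bb Bb' neqb dB.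
  exists [tuple a; a'; a3; c], [tuple b; b'; b3; d]; split=> //.
  have ini1 (x y z t : E) : initial [:: x; y; z; t] 1 = [set x].
    by apply/setP=> u; rewrite !inE.
  have ini2 (x y z t : E) : initial [:: x; y; z; t] 2 = [set x; y].
    by apply/setP=> u; rewrite !inE.
  have ini3 (C : {set E}) x y z t : is_ordering C [:: x; y; z; t] ->
      initial [:: x; y; z; t] 3 = C :\ t.
    case=> U <-; neqs_of U; apply/setP=> u; rewrite !inE.
    by have [->|_] := eqVneq u t; simp_neq; rewrite ?orbF.
  have ini4 (C : {set E}) x y z t : is_ordering C [:: x; y; z; t] ->
    initial [:: x; y; z; t] 4 = C by case.
  have [Ac Bd] : c \in A /\ d \in B by case/setDP: cA; case/setDP: dB.
  case=> [|[|[|[|[|//]]]]] // _; apply/andP; rewrite /=.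
  - by rewrite !ini1.
  - by rewrite !ini2.
  - rewrite (ini3 _ _ _ _ _ ordA) (ini3 _ _ _ _ _ ordB).
    by rewrite -/(exchangeable M A B _ _) exchangeable_compl ?sub1set.
  rewrite (ini4 _ _ _ _ _ ordA) (ini4 _ _ _ _ _ ordB) !setDv !set0U.
  by rewrite basisA basisB.
(* As a boolean predicate on a finite type, the existence of a crossing is decidable by [pickP]. *)
pose crossing (p : (E * E) * (E * E) * (E * E)) :=
  let: (a, a', (b, b'), (c, d)) := p in
  [&& [&& a \in A, a' \in A, b \in B & b' \in B], a != a', b != b',
    exchangeable M A B [set a; a'] [set b; b'], exchange_rel M A B a b,
    c \in A :\: [set a; a'], d \in B :\: [set b; b'] & exchange_rel M A B c d].
have [[[[a a'] [b b']] [c d]] /= | no] := pickP crossing.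
  case/and5P=> /and4P[Aa Aa' Bb Bb'] neqa neqb ex /and4P[].
  by move=> eab cA dB ecd; apply: (sufficient a a' b b' c d).
have nc : no_crossing M A B.
  move=> a a' b b' [Aa Aa' Bb Bb'] neqa neqb ex eab c d cA dB; apply/negP=> ecd.
  have /negP[] := negbT (no ((a, a'), (b, b'), (c, d))).
  by rewrite /= Aa Aa' Bb Bb' neqa neqb ex eab cA dB.
(* In a complete graph any exchangeable pair of pairs gives a crossing; otherwise a nonedge leads to
   the double star. *)
have [full | ] := boolP [forall a in A, forall b in B, exchange_rel M A B a b].
  have {}full a b : a \in A -> b \in B -> exchange_rel M A B a b.
    by move=> Aa Bb; apply: (forall_inP (forall_inP full a Aa)).
  have [a [a' [b [b' [mem neqa neqb ex]]]]] :=
    complete_exchange rankM basisA basisB disjAB full.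
  have [Aa Aa' Bb Bb'] := mem.
  have [c [c3 [UA defA]]] := ordering4 cardA Aa Aa' neqa.
  have [d [d3 [UB defB]]] := ordering4 cardB Bb Bb' neqb.
  have cA : c \in A :\: [set a; a'] by rewrite -defA; neqs_of UA; mem4.
  have dB : d \in B :\: [set b; b'] by rewrite -defB; neqs_of UB; mem4.
  apply: (sufficient a a' b b' c d) => //; first exact: full.
  by apply: full; [case/setDP: cA | case/setDP: dB].
rewrite negb_forall => /existsP[a]; rewrite negb_imply => /andP[Aa].
rewrite negb_forall => /existsP[b]; rewrite negb_imply => /andP[Bb neab].
have [||||a1 [b1 [Aa1 Bb1 star]]] :=
    @double_star E (exchange_rel M A B) A B cardA cardB.
- by move=> x; apply: exchange_rel_exists.
- move=> y By; have disjBA : [disjoint B & A] by rewrite disjoint_sym.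
  have [x Ax yx] := exchange_rel_exists basisB basisA disjBA By.
  by exists x; rewrite // exchange_relC.
- move=> x x' y Ax Ax' By exy nex'y.
  have [y' [By' neqy _ none]] := no_crossing_star disjAB nc Ax Ax' By exy nex'y.
  by exists y'.
- by exists a, b.
by case: (star_exchange_crossing cardA cardB basisA basisB disjAB Aa1 Bb1 star).
Qed.
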